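(* Let $1\le k\le n$ be integers and let $a,b\in\mathbb{R}$ be distinct. Then the Euclidean distance degree of the quadratic model $\operatorname{Gr}_{a,b}(k,n)\subseteq \mathsf{S}^2(\mathbb{R}^n)$ of the Grassmann manifold is \[ \mathsf{ED}\bigl(\operatorname{Gr}_{a,b}(k,n)\bigr)=\binom{n}{k}. \]
   Context: For $\mathbb{F}=\mathbb{R}$ or $\mathbb{C}$, $\mathsf{S}^2(\mathbb{F}^n)=\{X\in\mathbb{F}^{n\times n}: X^{\mathsf T}=X\}$ (transpose, not conjugate transpose, also over $\mathbb{C}$). Quadratic model: $\operatorname{Gr}_{a,b}(k,n)=\{X\in \mathsf{S}^2(\mathbb{R}^n): (X-aI)(X-bI)=0,\ \operatorname{tr}(X)=ak+b(n-k)\}$. Its complex locus $\operatorname{Gr}_{a,b}(k,n)^{\mathbb{C}}$ is the set of $X\in \mathsf{S}^2(\mathbb{C}^n)$ satisfying the same equations; it is a smooth affine variety. Euclidean distance degree: for a real affine variety $\mathcal{M}\subseteq \mathsf{S}^2(\mathbb{R}^n)$ with smooth complex locus $\mathcal{M}^{\mathbb{C}}$, and $A\in \mathsf{S}^2(\mathbb{R}^n)$, let $\delta_A:\mathcal{M}^{\mathbb{C}}\to\mathbb{C}$, $\delta_A(X)=\tfrac12\sum_{i,j}(x_{ij}-a_{ij})^2$ (no absolute values). A point $X\in\mathcal{M}^{\mathbb{C}}$ is stationary if $\operatorname{tr}(Y^{\mathsf T}(X-A))=0$ for all $Y$ in the tangent space $\mathbb{T}_X\mathcal{M}^{\mathbb{C}}$.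 Then $\mathsf{ED}(\mathcal{M})=N$ means that for generic $A$ (all $A\in \mathsf{S}^2(\mathbb{R}^n)$ outside some proper real algebraic subset) $\delta_A$ has exactly $N$ stationary points in $\mathcal{M}^{\mathbb{C}}$. *)

(* Defs.v *)
From HB Require Import structures.
From mathcomp Require Import all_boot all_order all_algebra.
From mathcomp Require Import complex reals.
From mathcomp Require Import mpoly.

Set Implicit Arguments.
Unset Strict Implicit.
Unset Printing Implicit Defensive.

Import GRing.Theory.
Local Open Scope ring_scope.

(** Polynomial functions on n x n matrices are [{mpoly F[n * n]}]; the variable
    of index [mxvec_index i j] is the entry (i, j). *)
Definition entries (F : comNzRingType) (n : nat) (X : 'M[F]_n)
  : 'I_(n * n) -> F := fun l => mxvec X 0 l.

(** Zero set, inside S^2(F^n), of a finite system of polynomial equations. *)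
Definition sym_locus (F : comNzRingType) (n : nat) (E : seq {mpoly F[n * n]})
    (X : 'M[F]_n) : Prop :=
  X^T = X /\ forall p, p \in E -> p.@[entries X] = 0.

(** A real affine variety in S^2(R^n) is given by its equations [E]: its real
    points are [sym_locus E], and its complex points are the solutions of the
    same equations in S^2(C^n). *)
Definition complex_locus (R : realType) (n : nat) (E : seq {mpoly R[n * n]})
  : 'M[R[i]]_n -> Prop := sym_locus (map (map_mpoly (real_complex R)) E).

(** Zariski tangent space at X of a set M of matrices: Y is tangent when the
    differential at X of every polynomial vanishing on all of M kills Y.  The
    whole vanishing ideal is used, so the result depends only on M and not on
    the equations chosen; if M lies in S^2 the linear forms x_ij - x_ji belong
    to the ideal, which forces Y to be symmetric. *)
Definition tangent (F : comNzRingType) (n : nat) (M : 'M[F]_n -> Prop)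
    (X Y : 'M[F]_n) : Prop :=
  forall p : {mpoly F[n * n]},
    (forall Z, M Z -> p.@[entries Z] = 0) ->
    \sum_l (p^`M(l)).@[entries X] * entries Y l = 0.

(** Stationary points on M of X |-> 1/2 \sum_(i, j) (x_ij - a_ij)^2: no
    conjugation and no absolute value, also over the complex numbers. *)
Definition stationary (F : comNzRingType) (n : nat) (M : 'M[F]_n -> Prop)
    (A X : 'M[F]_n) : Prop :=
  M X /\ forall Y, tangent M X Y -> \tr (Y^T *m (X - A)) = 0.

Definition has_exactly (T : eqType) (P : T -> Prop) (N : nat) : Prop :=
  exists s : seq T, [/\ uniq s, size s = N & forall x, P x <-> x \in s].

(** "For generic A in S^2(R^n)": outside some proper real algebraic subset
    [sym_locus D] of S^2(R^n). *)
Definition generically (R : realType) (n : nat) (P : 'M[R]_n -> Prop) : Prop :=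
  exists D : seq {mpoly R[n * n]},
    (exists A : 'M[R]_n, A^T = A /\ ~ sym_locus D A) /\
    (forall A : 'M[R]_n, A^T = A -> ~ sym_locus D A -> P A).

(** ED(M) = N, for the real affine variety M with equations [E] (meant for M
    with smooth complex locus). *)
Definition ED_degree_is (R : realType) (n : nat) (E : seq {mpoly R[n * n]})
    (N : nat) : Prop :=
  generically (fun A : 'M[R]_n =>
    has_exactly
      (stationary (complex_locus E) (map_mx (real_complex R) A)) N).

Definition generic_mx (F : comNzRingType) (n : nat) : 'M[{mpoly F[n * n]}]_n :=
  \matrix_(i, j) 'X_(mxvec_index i j).

(** Gr_{a,b}(k, n) as a real affine variety: the entries of
    (X - a I)(X - b I) and the trace condition (intended for k <= n). *)
Definition quadratic_model (F : comNzRingType) (a b : F) (k n : nat)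
  : seq {mpoly F[n * n]} :=
  let X := generic_mx F n in
  (\tr X - (a *+ k + b *+ (n - k))%:MP) ::
  [seq ((X - a%:MP%:M) *m (X - b%:MP%:M)) i j | i <- enum 'I_n, j <- enum 'I_n].

Lemma generic_mx_eval (F : comNzRingType) (n : nat) (X : 'M[F]_n) :
  map_mx (meval (entries X)) (generic_mx F n) = X.
Proof. by apply/matrixP=> i j; rewrite !mxE mevalXU /entries mxvecE. Qed.

Lemma sym_locus_quadratic_model (F : comNzRingType) (a b : F) (k n : nat)
    (X : 'M[F]_n) :
  sym_locus (quadratic_model a b k n) X <->
  [/\ X^T = X, (X - a%:M) *m (X - b%:M) = 0
    & \tr X = a *+ k + b *+ (n - k)].
Proof.
set ev := meval (entries X); set G := generic_mx F n.
have evtr : ev (\tr G - (a *+ k + b *+ (n - k))%:MP)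
            = \tr X - (a *+ k + b *+ (n - k)).
  by rewrite /ev mevalB mevalC -trace_map_mx generic_mx_eval.
have evmul : map_mx ev ((G - a%:MP%:M) *m (G - b%:MP%:M))
             = (X - a%:M) *m (X - b%:M).
  by rewrite map_mxM !map_mxB !map_scalar_mx /= generic_mx_eval /ev !mevalC.
split=> [[symX zX]|[symX mulX trX]]; split=> //.
- apply/matrixP=> i j; rewrite -evmul !mxE.
  have := zX (((G - a%:MP%:M) *m (G - b%:MP%:M)) i j).
  rewrite mxE; apply; rewrite inE; apply/orP; right.
  by apply/allpairsP; exists (i, j); rewrite !mem_enum !mxE.
- by apply/eqP; rewrite -subr_eq0 -evtr; apply/eqP/zX; rewrite inE eqxx.
move=> p; rewrite inE => /orP[/eqP->|/allpairsP[[i j] [_ _ ->]]].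
  by rewrite -/ev evtr trX subrr.
by have /matrixP/(_ i j) := evmul; rewrite mulX mxE [RHS]mxE.
Qed.

Lemma complex_locus_quadratic_model (R : realType) (a b : R) (k n : nat)
    (X : 'M[R[i]]_n) :
  complex_locus (quadratic_model a b k n) X <->
  [/\ X^T = X, (X - (real_complex R a)%:M) *m (X - (real_complex R b)%:M) = 0
    & \tr X = real_complex R a *+ k + real_complex R b *+ (n - k)].
Proof.
rewrite -sym_locus_quadratic_model /complex_locus.
suff -> : map (map_mpoly (real_complex R)) (quadratic_model a b k n)
          = quadratic_model (real_complex R a) (real_complex R b) k n by [].
set f := map_mpoly (real_complex R).
have fG : map_mx f (generic_mx R n) = generic_mx _ n.
  by apply/matrixP=> i j; rewrite !mxE /f map_mpolyX.
rewrite /quadratic_model /=; congr cons.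
  rewrite /f rmorphB /= -trace_map_mx -/f fG /f map_mpolyC.
  by congr (_ - _%:MP); rewrite raddfD !raddfMn.
rewrite map_allpairs; apply: eq_allpairs => // i j.
have -> : f (((generic_mx R n - a%:MP%:M) *m (generic_mx R n - b%:MP%:M)) i j)
  = (map_mx f ((generic_mx R n - a%:MP%:M) *m (generic_mx R n - b%:MP%:M))) i j.
  by rewrite [RHS]mxE.
by rewrite map_mxM !map_mxB !map_scalar_mx /= fG /f !map_mpolyC.
Qed.

(* Main.v *)
(** The tangent space at a point X of the model consists of the commutators
    [K, X] with K skew: the rational curves t |-> Q(t) X Q(t)^T, where Q(t) is a
    rational parametrization of a plane rotation, show that the commutators with
    K = E_ij - E_ji are tangent, and stationarity along all of them says that X
    commutes with A.  Conversely, differentiating (X - a)(X - b) = 0 shows that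
    a tangent Y satisfies P Y P = 0 for P = X - b, so Y is orthogonal to X - A
    as soon as P and A commute.  When the symmetric matrix A has n distinct
    eigenvalues, it is diagonalizable and the X commuting with A are diagonal in
    the same eigenbasis (such X are automatically symmetric), with diagonal
    entries a and b; the trace fixes the number of a's to be k.  The eigenvalues
    are distinct exactly when the determinant of the matrix of power sums
    tr(A^(i+j)), which is their discriminant, does not vanish. *)

Require Import Defs.
From mathcomp Require Import all_boot all_order all_algebra.
From mathcomp Require Import complex reals mpoly.
From mathcomp Require Import ring.

Set Implicit Arguments.
Unset Strict Implicit.
Unset Printing Implicit Defensive.

Import Order.TTheory GRing.Theory Num.Theory.
Local Open Scope ring_scope.

(** * Differential of a polynomial along a vector *)

Section Differential.
Variables (F : comNzRingType) (m : nat).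
Implicit Types (x y : 'I_m -> F) (p q : {mpoly F[m]}).

Definition mdiff x y p := \sum_l (p^`M(l)).@[x] * y l.

Lemma mdiffD x y p q : mdiff x y (p + q) = mdiff x y p + mdiff x y q.
Proof.
by rewrite -big_split; apply: eq_bigr => l _; rewrite mderivD mevalD mulrDl.
Qed.

Lemma mdiffM x y p q :
  mdiff x y (p * q) = mdiff x y p * q.@[x] + p.@[x] * mdiff x y q.
Proof.
rewrite mulr_suml mulr_sumr -big_split; apply: eq_bigr => l _.
by rewrite mderivM mevalD !mevalM mulrDl mulrAC mulrA.
Qed.

Lemma mdiffC x y c : mdiff x y c%:MP = 0.
Proof. by rewrite /mdiff big1 // => l _; rewrite mderivC meval0 mul0r. Qed.

Lemma mdiffB x y p q : mdiff x y (p - q) = mdiff x y p - mdiff x y q.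
Proof.
by rewrite -mulN1r -mpolyCN mdiffD mdiffM mdiffC mevalC mul0r add0r mulN1r.
Qed.

Lemma mdiffX x y i : mdiff x y 'X_i = y i.
Proof.
rewrite /mdiff (bigD1 i) //= big1 ?addr0 => [|l /negPf li].
  rewrite mderivX mnm1E eqxx scale1r -[X in (X - _)%MM]add0m addmK mpolyX0.
  by rewrite meval1 mul1r.
by rewrite mderivX mnm1E eq_sym li scale0r meval0 mul0r.
Qed.

Lemma mdiff_sum x y (I : Type) (r : seq I) (P : pred I) (G : I -> {mpoly F[m]}) :
  mdiff x y (\sum_(i <- r | P i) G i) = \sum_(i <- r | P i) mdiff x y (G i).
Proof.
elim/big_rec2: _ => [|i u v _ <-]; last by rewrite mdiffD.
by rewrite -mpolyC0 mdiffC.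
Qed.

End Differential.

(** * Velocities of rational curves as tangent vectors *)

Lemma mpoly_ring_ind (F : nzRingType) (m : nat) (P : {mpoly F[m]} -> Prop) :
  (forall c, P c%:MP) -> (forall i, P 'X_i) ->
  (forall p q, P p -> P q -> P (p + q)) ->
  (forall p q, P p -> P q -> P (p * q)) -> forall p, P p.
Proof.
move=> PC PX PD PM; elim/mpolyind => [|c mm p _ _ Pp]; first exact: (PC 0).
apply: (PD) => //; rewrite -mul_mpolyC; apply: (PM) => //.
rewrite mpolyXE_id; elim/big_ind: _ => [|//|i _]; first exact: (PC 1).
by elim: (mm i) => [|e IH]; [exact: (PC 1) | rewrite exprS; apply: PM].
Qed.

(* The hypotheses on [d] make the velocity at [0] of the rational curve [N / d]
   equal to the derivative of [N] at [0]. *)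
Lemma mdiff_rational_curve (F : fieldType) (m : nat) (d : {poly F})
    (N : 'I_m -> {poly F}) (p : {mpoly F[m]}) :
  d.[0] = 1 -> d^`().[0] = 0 ->
  exists e q,
    (forall t, d.[t] != 0 ->
       q.[t] = d.[t] ^+ e * p.@[fun l => (N l).[t] / d.[t]]) /\
    q^`().[0] = mdiff (fun l => (N l).[0]) (fun l => (N l)^`().[0]) p.
Proof.
move=> d0 d'0.
(* Powers of [d] have value 1 and derivative 0 at 0, so clearing denominators by them changes
   neither the value nor the derivative there. *)
have dX e : (d ^+ e)^`().[0] = 0.
  by rewrite deriv_exp hornerMn hornerM d'0 mul0r mul0rn.
have ev0 e q (r : {mpoly F[m]}) : (forall t, d.[t] != 0 ->
       q.[t] = d.[t] ^+ e * r.@[fun l => (N l).[t] / d.[t]]) ->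
    q.[0] = r.@[fun l => (N l).[0]].
  move=> ->; last by rewrite d0 oner_eq0.
  rewrite d0 expr1n mul1r; apply: meval_eq => l /=.
  by rewrite divr1.
elim/mpoly_ring_ind: p => [c|i|p1 p2 [e1 [q1 [E1 D1]]] [e2 [q2 [E2 D2]]]
                              |p1 p2 [e1 [q1 [E1 D1]]] [e2 [q2 [E2 D2]]]].
- exists 0, c%:P; rewrite derivC horner0 mdiffC; split => // t _.
  by rewrite hornerC mevalC mul1r.
- exists 1, (N i); rewrite mdiffX; split => // t dt.
  by rewrite mevalXU mulrC divfK.
- exists (e1 + e2)%N, (d ^+ e2 * q1 + d ^+ e1 * q2); split=> [t dt|].
    by rewrite !hornerE E1 // E2 // mevalD exprD; ring.
  rewrite derivD !derivM !hornerD !hornerM !dX mdiffD -D1 -D2 !horner_exp d0 !expr1n.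
  by rewrite !mul0r !mul1r !add0r.
- exists (e1 + e2)%N, (q1 * q2); split=> [t dt|].
    by rewrite !hornerE E1 // E2 // mevalM exprD; ring.
  by rewrite derivM !hornerE mdiffM -D1 -D2 (ev0 _ _ _ E1) (ev0 _ _ _ E2).
Qed.

Lemma poly_eq0_off_roots (F : numDomainType) (d q : {poly F}) :
  d != 0 -> (forall t, d.[t] != 0 -> q.[t] = 0) -> q = 0.
Proof.
move=> d0 qE; suff: d * q = 0.
  by move/eqP; rewrite mulf_eq0 (negPf d0) => /eqP.
(* [d * q] vanishes everywhere, and in characteristic 0 the naturals supply as many distinct roots
   as its size requires. *)
apply: (@roots_geq_poly_eq0 _ _ [seq i%:R | i <- iota 0 (size (d * q))]).
- apply/allP => t _; rewrite /root hornerM mulf_eq0.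
  by case: eqVneq => //= /qE ->.
- by rewrite map_inj_uniq ?iota_uniq // => i j /eqP; rewrite eqr_nat => /eqP.
- by rewrite size_map size_iota.
Qed.

(** A polynomial vanishing on [M], pulled back along [N / d] and cleared of denominators, is a
    polynomial in [t] that vanishes wherever [d] does not, hence is zero; its derivative at 0 is the
    differential along the velocity. *)
Lemma tangent_rational_curve (F : numFieldType) (n : nat) (M : 'M[F]_n -> Prop)
    (d : {poly F}) (N : 'M[{poly F}]_n) :
  d.[0] = 1 -> d^`().[0] = 0 ->
  (forall t, d.[t] != 0 -> M (d.[t]^-1 *: map_mx (horner_eval t) N)) ->
  tangent M (map_mx (horner_eval 0) N) (map_mx (horner_eval 0 \o deriv) N).
Proof.
move=> d0 d'0 MN p pM; have d_neq0 : d != 0.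
  by apply: contra_eq_neq d0 => ->; rewrite horner0 eq_sym oner_neq0.
have [e [q [Eq Dq]]] := mdiff_rational_curve (entries N) p d0 d'0.
have q0 : q = 0.
  apply: (poly_eq0_off_roots d_neq0) => t dt; rewrite Eq //.
  rewrite -[X in _ * X = _](_ : p.@[entries (d.[t]^-1 *: map_mx (horner_eval t) N)] = _).
    by rewrite pM ?mulr0 //; apply: MN.
  apply: meval_eq => l; case/mxvec_indexP: l => i j.
  by rewrite /entries !mxvecE !mxE /horner_eval mulrC.
move: Dq; rewrite q0 deriv0 horner0 => Dq; rewrite [RHS]Dq.
apply: eq_bigr => l _; congr (_ * _); last first.
  by case/mxvec_indexP: l => i j; rewrite /entries !mxvecE !mxE.
apply: meval_eq => l'; case/mxvec_indexP: l' => i j.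
by rewrite /entries !mxvecE !mxE.
Qed.

(** * Rational parametrization of rotations *)

(* For a skew matrix [K] with [K^3 = - K], [rotation_mx t K / (1 + t^2)] is the
   rotation [exp (s K)] of angle [s = 2 atan t]. *)
Definition rotation_mx (F : comNzRingType) (n : nat) (t : F) (K : 'M[F]_n) :=
  (1 + t ^+ 2)%:M + (t *+ 2) *: K + (t ^+ 2 *+ 2) *: (K *m K).

Lemma map_rotation_mx (F G : comNzRingType) (f : {rmorphism F -> G}) (n : nat)
    (t : F) (K : 'M[F]_n) :
  map_mx f (rotation_mx t K) = rotation_mx (f t) (map_mx f K).
Proof.
rewrite /rotation_mx !map_mxD !map_mxZ map_mxM map_scalar_mx /=.
by rewrite !raddfMn /= !rmorphD rmorph1 !rmorphXn.
Qed.

(** With [s = 1 + t^2] the product is [(s + 2 t^2 K^2)^2 - 4 t^2 K^2]; since [K^4 = - K^2], the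
    coefficient of [K^2] is [4 t^2 (s - t^2 - 1) = 0]. *)
Lemma rotation_mxK (F : comNzRingType) (n : nat) (t : F) (K : 'M[F]_n) :
  K *m K *m K = - K ->
  rotation_mx t K *m rotation_mx t (- K) = ((1 + t ^+ 2) ^+ 2)%:M.
Proof.
move=> K3; rewrite /rotation_mx mulNmx mulmxN opprK.
have K4 : K *m K *m (K *m K) = - (K *m K) by rewrite mulmxA K3 mulNmx.
have K3' : K *m (K *m K) = - K by rewrite mulmxA.
rewrite !mulmxDl !mulmxDr -!scalar_mxM !mul_scalar_mx !mul_mx_scalar.
rewrite -!scalemxAl -!scalemxAr !mulmxN K3 K3' K4.
apply/matrixP => i j; rewrite !mxE; ring.
Qed.

Lemma tr_rotation_mx (F : comNzRingType) (n : nat) (t : F) (K : 'M[F]_n) :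
  K^T = - K -> (rotation_mx t K)^T = rotation_mx t (- K).
Proof.
move=> KT; rewrite /rotation_mx !linearD /= !linearZ /= tr_scalar_mx trmx_mul.
by rewrite KT.
Qed.

Lemma deriv_horner_mulmx (F : comNzRingType) (m n p : nat) (t : F)
    (A : 'M[{poly F}]_(m, n)) (B : 'M[{poly F}]_(n, p)) :
  map_mx (horner_eval t \o deriv) (A *m B) =
    map_mx (horner_eval t \o deriv) A *m map_mx (horner_eval t) B +
    map_mx (horner_eval t) A *m map_mx (horner_eval t \o deriv) B.
Proof.
apply/matrixP => i j; rewrite !mxE /= /horner_eval linear_sum horner_sum.
rewrite -big_split; apply: eq_bigr => l _ /=.
by rewrite !mxE /= derivM hornerD !hornerM.
Qed.

Lemma deriv_rotation_mx (F : comNzRingType) (n : nat) (K : 'M[F]_n) :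
  map_mx (horner_eval 0 \o deriv) (rotation_mx 'X (map_mx polyC K)) = K *+ 2.
Proof.
rewrite /rotation_mx -map_mxM; apply/matrixP => i j; rewrite !mxE /= /horner_eval.
rewrite !derivE !(hornerE, hornerMn) /=; ring.
Qed.

(** * Trace identities behind stationarity *)

Lemma mxtrace_commutator (F : comNzRingType) (n : nat) (A K X : 'M[F]_n) :
  \tr ((K *m X - X *m K) *m (X - A)) = \tr (K *m (A *m X - X *m A)).
Proof.
rewrite !mulmxBl !mulmxBr !linearB /= -2![X *m K *m _]mulmxA.
(* By cyclicity the two terms free of [A] cancel, and the other two pair [K] with the commutator of
   [A] and [X]. *)
rewrite [\tr (X *m (K *m X))]mxtrace_mulC [\tr (X *m (K *m A))]mxtrace_mulC.
by rewrite !mulmxA opprB addrC addrA subrK.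
Qed.

(** [P / r] is a projection. The equation on [Y] makes both diagonal blocks of [Y] vanish, while [B]
    is block diagonal, so [B Y] has no diagonal blocks. *)
Lemma mxtrace_commuting_tangent (F : fieldType) (n : nat) (r : F)
    (P B Y : 'M[F]_n) :
  r != 0 -> P *m P = r *: P -> B *m P = P *m B ->
  Y *m P + P *m Y = r *: Y -> \tr (B *m Y) = 0.
Proof.
move=> r0 PP BP YP.
have PYP : P *m Y *m P = 0.
  have := congr1 (mulmx P) YP; rewrite mulmxDr !mulmxA PP -scalemxAl -scalemxAr.
  by rewrite -[RHS]add0r => /addIr.
have trBPYP : \tr (B *m P *m Y *m P) = 0.
  by rewrite -!mulmxA [P *m (Y *m P)]mulmxA PYP mulmx0 mxtrace0.
(* One factor [r] turns [r Y] into [Y P + P Y], a second turns [r P] into [P P]; each term is then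
   cyclically the trace of [B P Y P]. *)
apply: (mulfI r0); rewrite mulr0 -mxtraceZ scalemxAr -YP mulmxDr linearD /=.
apply: (mulfI r0); rewrite mulr0 mulrDr -!mxtraceZ.
rewrite [r *: _]scalemxAr [r *: (Y *m P)]scalemxAr -PP.
rewrite [r *: (B *m _)]scalemxAr [r *: (P *m Y)]scalemxAl -PP !mulmxA.
rewrite [\tr (B *m Y *m P *m P)]mxtrace_mulC !mulmxA -BP trBPYP add0r.
by rewrite BP -!mulmxA mxtrace_mulC !mulmxA trBPYP.
Qed.

(** * Stationary points are the points commuting with [A] *)

Section QuadraticModel.
Variables (F : numFieldType) (n : nat) (a b c : F) (M : 'M[F]_n -> Prop).
Hypothesis ME : forall X, M X <->
  [/\ X^T = X, (X - a%:M) *m (X - b%:M) = 0 & \tr X = c].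

(** [Q] is orthogonal up to scale; as [Q] and [Q^T] both occur, one division by [r] normalizes the
    conjugation without a square root. *)
Lemma quadratic_model_conj (r : F) (Q X : 'M[F]_n) :
  r != 0 -> Q^T *m Q = r%:M -> Q *m Q^T = r%:M -> M X ->
  M (r^-1 *: (Q *m X *m Q^T)).
Proof.
move=> r0 QTQ QQT /ME[XT XE trX]; apply/ME; split.
- by rewrite linearZ /= !trmx_mul trmxK XT mulmxA.
- have sE (s : F) : r^-1 *: (Q *m X *m Q^T) - s%:M
      = r^-1 *: (Q *m (X - s%:M) *m Q^T).
    rewrite mulmxBr mulmxBl mul_mx_scalar -scalemxAl QQT scalerBr.
    by rewrite scale_scalar_mx scale_scalar_mx mulrCA mulVf // mulr1.
  rewrite !sE -scalemxAl -scalemxAr -!mulmxA [Q^T *m (Q *m _)]mulmxA QTQ.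
  rewrite mul_scalar_mx -!scalemxAr [(X - a%:M) *m (_ *m _)]mulmxA XE.
  by rewrite mul0mx mulmx0 !scaler0.
- rewrite mxtraceZ -mulmxA mxtrace_mulC -mulmxA QTQ mul_mx_scalar mxtraceZ.
  by rewrite mulrA mulVf // mul1r.
Qed.

(** This is the velocity at 0 of the rotated point [Q X Q^T / d]; the factor 2 comes from the
    derivative [2 K] of [Q] at 0. *)
Lemma tangent_commutator (K X : 'M[F]_n) :
  K^T = - K -> K *m K *m K = - K -> M X ->
  tangent M X ((K *m X - X *m K) *+ 2).
Proof.
move=> KT K3 MX; pose Kp := map_mx polyC K; pose Q := rotation_mx 'X Kp.
(* Each of [Q] and [Q^T] contributes one factor [1 + t^2] to the denominator. *)
pose d : {poly F} := (1 + 'X^2) ^+ 2.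
have KpT : Kp^T = - Kp by rewrite /Kp map_trmx KT map_mxN.
have Qt t : map_mx (horner_eval t) Q = rotation_mx t K.
  rewrite map_rotation_mx /= /horner_eval hornerX; congr rotation_mx.
  by apply/matrixP => i j; rewrite !mxE hornerC.
have QTt t : map_mx (horner_eval t) Q^T = (rotation_mx t K)^T.
  by rewrite -map_trmx Qt.
have Xt t : map_mx (horner_eval t) (map_mx polyC X) = X.
  by apply/matrixP => i j; rewrite !mxE /horner_eval hornerC.
have X't : map_mx (horner_eval 0 \o deriv) (map_mx polyC X) = 0.
  by apply/matrixP => i j; rewrite !mxE /= /horner_eval derivC hornerC.
have Q0 : rotation_mx 0 K = 1%:M.
  by rewrite /rotation_mx expr0n addr0 !mul0rn !scale0r !addr0.
have dE t : d.[t] = (1 + t ^+ 2) ^+ 2 by rewrite /d !hornerE.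
pose N := Q *m map_mx polyC X *m Q^T.
have -> : (K *m X - X *m K) *+ 2 = map_mx (horner_eval 0 \o deriv) N.
  rewrite /N 2!deriv_horner_mulmx X't mulmx0 addr0 map_mxM Xt Qt QTt Q0.
  rewrite trmx1 mulmx1 mul1mx /Q (tr_rotation_mx _ KpT) -map_mxN.
  by rewrite !deriv_rotation_mx -!scaler_nat -scalemxAl -scalemxAr mulmxN -scalerDr.
have -> : X = map_mx (horner_eval 0) N.
  by rewrite /N !map_mxM Xt Qt QTt Q0 trmx1 mulmx1 mul1mx.
apply: (@tangent_rational_curve _ _ _ d).
- by rewrite dE expr0n addr0 expr1n.
- by rewrite /d !derivE !hornerE /=; ring.
move=> t; rewrite dE => dt; rewrite /N !map_mxM Qt QTt Xt.
have NK3 : - K *m - K *m - K = - - K by rewrite mulmxN mulNmx mulmxN opprK K3.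
apply: quadratic_model_conj => //; rewrite tr_rotation_mx //.
  by rewrite -{2}[K]opprK rotation_mxK.
by rewrite rotation_mxK.
Qed.

(** [A X - X A] is skew for symmetric [A] and [X], so pairing it with every [E_ij - E_ji] detects
    all its entries. *)
Lemma stationary_comm (A X : 'M[F]_n) :
  A^T = A -> stationary M A X -> X *m A = A *m X.
Proof.
move=> AT [MX stX]; have [XT _ _] := (ME X).1 MX.
pose L := A *m X - X *m A; apply/esym/eqP; rewrite -subr_eq0 -/L.
have LT : L^T = - L by rewrite /L linearB /= !trmx_mul AT XT opprB.
have LTE i j : L i j = - L j i.
  by have /matrixP/(_ j i) := LT; rewrite [LHS]mxE [RHS]mxE.
apply/eqP/matrixP => i j; rewrite [RHS]mxE.
have [->|ij] := eqVneq i j; last have ji : j != i by rewrite eq_sym.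
  by apply/eqP; rewrite -eqNr -LTE.
pose K : 'M[F]_n := delta_mx i j - delta_mx j i.
have KT : K^T = - K by rewrite /K linearB /= !trmx_delta opprB.
have K2 : K *m K = - (delta_mx i i + delta_mx j j).
  rewrite mulmxBl !mulmxBr !mul_delta_mx !mul_delta_mx_0 //.
  by rewrite sub0r subr0 -opprD addrC.
(* [- K^2] is the projection onto the plane of coordinates [i] and [j], and [K] acts inside that
   plane. *)
have K3 : K *m K *m K = - K.
  rewrite K2 mulNmx mulmxDl !mulmxBr !mul_delta_mx !mul_delta_mx_0 //.
  by rewrite subr0 sub0r.
have trd u v (B : 'M[F]_n) : \tr (delta_mx u v *m B) = B v u.
  rewrite /mxtrace (bigD1 u) //= big1 ?addr0 => [|w wu].
    rewrite mxE (bigD1 v) //= big1 ?addr0 => [|w wv]; rewrite mxE ?eqxx ?mul1r //.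
    by rewrite (negPf wv) andbF mul0r.
  by rewrite mxE big1 // => z _; rewrite mxE (negPf wu) mul0r.
have := stX _ (tangent_commutator KT K3 MX).
(* The commutator of a skew and a symmetric matrix is symmetric, which removes the transpose from
   the stationarity condition. *)
have -> : ((K *m X - X *m K) *+ 2)^T = (K *m X - X *m K) *+ 2.
  by rewrite linearMn /= linearB /= !trmx_mul KT XT mulNmx mulmxN opprK addrC.
have trKL : \tr ((K *m X - X *m K) *m (X - A)) = L j i *+ 2.
  by rewrite mxtrace_commutator -/L mulmxBl linearB /= !trd [L i j]LTE opprK.
rewrite mulr2n mulmxDl linearD /= trKL -mulrnDr => /eqP.
by rewrite mulrn_eq0 /= => /eqP Lji; rewrite LTE Lji oppr0.
Qed.

Lemma mdiff_quadratic_model (X Y : 'M[F]_n) (i j : 'I_n) :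
  let G := generic_mx F n in
  mdiff (entries X) (entries Y) (((G - a%:MP%:M) *m (G - b%:MP%:M)) i j) =
    (Y *m (X - b%:M) + (X - a%:M) *m Y) i j.
Proof.
move=> G; rewrite !mxE mdiff_sum -big_split; apply: eq_bigr => l _ /=.
rewrite mdiffM.
have mG s u v : (G - s%:MP%:M) u v = 'X_(mxvec_index u v) - (s *+ (u == v))%:MP.
  by rewrite !mxE mpolyCMn.
by rewrite !mG !mdiffB !mdiffX !mdiffC !subr0 !mevalB !mevalXU !mevalC
  /entries !mxvecE !mxE.
Qed.

Lemma comm_stationary (A X : 'M[F]_n) :
  a != b -> A^T = A -> M X -> X *m A = A *m X -> stationary M A X.
Proof.
move=> ab AT MX XA; split=> // Y tY; have [XT XE _] := (ME X).1 MX.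
have YE : Y *m (X - b%:M) + (X - a%:M) *m Y = 0.
  apply/matrixP => i j; rewrite -mdiff_quadratic_model [RHS]mxE; apply: tY.
  move=> Z /ME[_ /matrixP/(_ i j) ZE _]; move: ZE.
  have <- : map_mx (meval (entries Z))
      ((generic_mx F n - a%:MP%:M) *m (generic_mx F n - b%:MP%:M))
    = (Z - a%:M) *m (Z - b%:M).
    by rewrite map_mxM !map_mxB !map_scalar_mx /= generic_mx_eval !mevalC.
  by rewrite mxE [RHS]mxE.
have BT : (X - A)^T = X - A by rewrite linearB /= XT AT.
rewrite -mxtrace_tr trmx_mul trmxK BT.
have ab0 : a - b != 0 by rewrite subr_eq0.
(* With [P = X - b], the relations become [P^2 = (a - b) P] and [Y P + P Y = (a - b) Y]. *)
have XaE : X - a%:M = X - b%:M - (a - b)%:M by rewrite raddfB /= opprB addrA subrK.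
apply: (mxtrace_commuting_tangent (P := X - b%:M) ab0).
- apply/eqP; rewrite -subr_eq0 -mul_scalar_mx -mulmxBl -XaE; exact/eqP.
- rewrite !mulmxBl !mulmxBr XA !mul_mx_scalar !mul_scalar_mx.
  by rewrite !opprD !addrA; congr (_ + _); exact: addrAC.
- apply/eqP; rewrite -subr_eq0 -mul_scalar_mx -addrA -mulmxBl -XaE; exact/eqP.
Qed.

End QuadraticModel.

(** * The discriminant as a determinant of power sums *)

(* When [A] has eigenvalues [d], this is [V *m V^T] for the Vandermonde matrix
   [V] of [d], so its determinant is the discriminant of [d]. *)
Definition power_sum_mx (F : nzRingType) (n : nat) (A : 'M[F]_n) : 'M[F]_n :=
  \matrix_(i, j) \tr (A ^+ (i + j)).

Lemma map_mx_exp (F G : nzRingType) (f : {rmorphism F -> G}) (n : nat)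
    (A : 'M[F]_n) (m : nat) :
  map_mx f (A ^+ m) = map_mx f A ^+ m.
Proof.
by elim: m => [|m IH]; rewrite ?expr0 ?map_mx1 // !exprS map_mxM IH.
Qed.

Lemma map_power_sum_mx (F G : nzRingType) (f : {rmorphism F -> G}) (n : nat)
    (A : 'M[F]_n) :
  map_mx f (power_sum_mx A) = power_sum_mx (map_mx f A).
Proof.
by apply/matrixP => i j; rewrite !mxE -trace_map_mx map_mx_exp.
Qed.

Lemma power_sum_mx_diag (F : fieldType) (n : nat) (P : 'M[F]_n) (d : 'rV[F]_n) :
  P \in unitmx ->
  power_sum_mx (invmx P *m diag_mx d *m P) = Vandermonde n d *m (Vandermonde n d)^T.
Proof.
move=> PU; have pow m : (invmx P *m diag_mx d *m P) ^+ m
    = invmx P *m diag_mx (\row_j d 0 j ^+ m) *m P.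
  elim: m => [|m IH].
    rewrite expr0 [diag_mx _](_ : _ = 1%:M) ?mulmx1 ?mulVmx //.
    by apply/matrixP => i j; rewrite !mxE expr0.
  rewrite exprS IH -[LHS]/(_ *m _) !mulmxA mulmxK //.
  rewrite -[_ *m _ *m diag_mx (\row__ _)]mulmxA.
  rewrite mulmx_diag; congr (_ *m diag_mx _ *m _).
  by apply/rowP => j; rewrite !mxE exprS.
apply/matrixP => i j; rewrite !mxE pow mxtrace_mulC mulKVmx // mxtrace_diag.
by apply: eq_bigr => l _; rewrite !mxE exprD.
Qed.

Lemma comm_diag_mx (F : idomainType) (n : nat) (d : 'rV[F]_n) (X : 'M[F]_n) :
  injective (d 0) -> X *m diag_mx d = diag_mx d *m X ->
  X = diag_mx (\row_i X i i).
Proof.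
move=> dI XD; apply/matrixP => i j; rewrite !mxE.
have [->|ij] := eqVneq i j; first by rewrite mulr1n.
have /matrixP/(_ i j) := XD; rewrite mul_mx_diag mul_diag_mx !mxE mulrC => /eqP.
by rewrite -subr_eq0 -mulrBl mulf_eq0 subr_eq0 (inj_eq dI) eq_sym (negPf ij) => /eqP.
Qed.

Lemma det_power_sum_mx_neq0 (F : fieldType) (n : nat) (P : 'M[F]_n)
    (d : 'rV[F]_n) :
  P \in unitmx ->
  \det (power_sum_mx (invmx P *m diag_mx d *m P)) != 0 <-> injective (d 0).
Proof.
(* The determinant is the square of the Vandermonde product of differences. *)
move=> PU; rewrite power_sum_mx_diag // det_mulmx det_tr mulf_eq0 orbb.
rewrite det_Vandermonde; split=> [/prodf_neq0 dN i j dij|dI].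
  apply/eqP/contraT => ij; wlog lt_ij: i j dij ij / (i < j)%N => [th|].
    by move: (ij); rewrite neq_ltn => /orP[]; apply: th; rewrite // eq_sym.
  have /prodf_neq0/(_ j lt_ij) := dN i isT.
  by rewrite dij subrr eqxx.
apply/prodf_neq0 => i _; apply/prodf_neq0 => j ij.
by rewrite subr_eq0 (inj_eq dI) -(inj_eq val_inj) /= gtn_eqF.
Qed.

(** * Counting the symmetric solutions that commute with [A] *)

Section CommutingSolutions.
Variables (F : numFieldType) (n k : nat) (a b : F) (P : 'M[F]_n) (d : 'rV[F]_n).
Hypotheses (kn : (k <= n)%N) (ab : a != b) (PU : P \in unitmx).
Hypothesis dI : injective (d 0).
Let A := invmx P *m diag_mx d *m P.
Hypothesis AT : A^T = A.

Let eigvals (S : {set 'I_n}) : 'rV[F]_n := \row_i if i \in S then a else b.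
Let sol (S : {set 'I_n}) := invmx P *m diag_mx (eigvals S) *m P.

(** [P] need not be orthogonal: for diagonal [D], symmetry of [P^-1 D P] amounts to [D] commuting
    with [P P^T]. Symmetry of [A], whose eigenvalues are distinct, makes [P P^T] diagonal, and
    diagonal matrices commute. *)
Lemma tr_conj_diag_mx (e : 'rV[F]_n) :
  (invmx P *m diag_mx e *m P)^T = invmx P *m diag_mx e *m P.
Proof.
have PTU : P^T \in unitmx by rewrite unitmx_tr.
have trE (f : 'rV[F]_n) : (invmx P *m diag_mx f *m P)^T
    = P^T *m diag_mx f *m invmx P^T.
  by rewrite !trmx_mul tr_diag_mx trmx_inv mulmxA.
have GE (f : 'rV[F]_n) : P^T *m diag_mx f *m invmx P^T = invmx P *m diag_mx f *m P
    <-> P *m P^T *m diag_mx f = diag_mx f *m (P *m P^T).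
  split=> [|E]; last first.
    apply: (can_inj (mulmxK PTU)); apply: (can_inj (mulKmx PU)).
    by rewrite mulmxKV // !mulmxA mulmxV // mul1mx E mulmxA.
  move/(congr1 (fun Z => P *m Z *m P^T)).
  by rewrite !mulmxA mulmxKV // mulmxV // mul1mx => ->.
rewrite trE; apply/GE; have /GE : P^T *m diag_mx d *m invmx P^T = A by rewrite -trE.
by move/(comm_diag_mx dI) => ->; exact: diag_mxC.
Qed.

Lemma commuting_solutions :
  has_exactly (fun X => [/\ X^T = X, (X - a%:M) *m (X - b%:M) = 0,
                            \tr X = a *+ k + b *+ (n - k) & X *m A = A *m X])
              'C(n, k).
Proof.
have conjM (D E : 'M[F]_n) :
    (invmx P *m D *m P) *m (invmx P *m E *m P) = invmx P *m (D *m E) *m P.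
  by rewrite !mulmxA mulmxK.
have conjI : injective (fun D : 'M[F]_n => invmx P *m D *m P).
  have PVU : invmx P \in unitmx by rewrite unitmx_inv.
  by move=> D E /(can_inj (mulmxK PU)) /(can_inj (mulKmx PVU)).
have conjB (D : 'M[F]_n) s :
    invmx P *m D *m P - s%:M = invmx P *m (D - s%:M) *m P.
  by rewrite mulmxBr mulmxBl mul_mx_scalar -scalemxAl mulVmx // scalemx1.
have conjT (D : 'M[F]_n) : \tr (invmx P *m D *m P) = \tr D.
  by rewrite mxtrace_mulC mulKVmx.
have diagB (e : 'rV[F]_n) s : diag_mx e - s%:M = diag_mx (\row_i (e 0 i - s)).
  by apply/matrixP => i j; rewrite !mxE -mulrnBl.
have tr_eig (S : {set _}) : \tr (diag_mx (eigvals S)) = a *+ #|S| + b *+ (n - #|S|).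
  rewrite mxtrace_diag (bigID (mem S)) /=; congr (_ + _).
    rewrite (eq_bigr (fun=> a)) ?sumr_const // => i iS.
    by rewrite mxE iS.
  rewrite (eq_bigr (fun=> b)) => [|i /negPf iS]; last by rewrite mxE iS.
  rewrite sumr_const; congr (_ *+ _).
  by rewrite -[X in (X - _)%N]card_ord -(cardC (mem S)) addKn; apply: eq_card.
(* The trace is [(a - b) m + b n], so in characteristic 0 it determines the number [m] of entries
   equal to [a]. *)
have trace_inj m : (m <= n)%N ->
    a *+ m + b *+ (n - m) = a *+ k + b *+ (n - k) -> m = k.
  have splitb l : (l <= n)%N -> a *+ l + b *+ (n - l) = (a - b) *+ l + b *+ n.
    by move=> ln; rewrite -{2}(subnK ln) mulrnDr mulrnBl; ring.
  have ab0 : a - b != 0 by rewrite subr_eq0.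
  move=> mn; rewrite (splitb m mn) (splitb k kn) => /addIr.
  by rewrite -[LHS]mulr_natr -[RHS]mulr_natr => /(mulfI ab0)/eqP; rewrite eqr_nat => /eqP.
exists [seq sol U | U <- enum [set U : {set 'I_n} | #|U| == k]]; split.
- rewrite map_inj_uniq ?enum_uniq // => S T /conjI /matrixP ST.
  apply/setP => i; have := ST i i; rewrite !mxE eqxx !mulr1n.
  case: ifP; case: ifP => // _ _ /eqP; first by rewrite (negPf ab).
  by rewrite eq_sym (negPf ab).
- by rewrite size_map -cardE card_draws card_ord.
move=> X; split.
  case=> XT XE trX XA; have [D XD] : exists D, X = invmx P *m D *m P.
    by exists (P *m X *m invmx P); rewrite !mulmxA mulVmx // mul1mx mulmxKV.
  have DA : D *m diag_mx d = diag_mx d *m D.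
    by apply: conjI; rewrite /= -!conjM -XD.
  have DE := comm_diag_mx dI DA; set e := \row_i D i i in DE.
  have eE i : (e 0 i - a) * (e 0 i - b) = 0.
    have : (D - a%:M) *m (D - b%:M) = 0.
      by apply: conjI; rewrite /= -conjM -!conjB -XD XE mulmx0 mul0mx.
    rewrite DE !diagB mulmx_diag => /matrixP/(_ i i).
    by rewrite !mxE eqxx mulr1n.
  pose S := [set i | e 0 i == a].
  have eS : e = eigvals S.
    apply/rowP => i; rewrite [RHS]mxE inE; case: eqVneq => // eia.
    apply/eqP; have /eqP := eE i.
    by rewrite mulf_eq0 !subr_eq0 (negPf eia).
  apply/mapP; exists S; last by rewrite XD DE eS.
  rewrite mem_enum inE.
  have Sn : (#|S| <= n)%N by rewrite -[X in (_ <= X)%N]card_ord max_card.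
  by move: trX; rewrite XD conjT DE eS tr_eig => /(trace_inj _ Sn)/eqP.
case/mapP => S; rewrite mem_enum inE => /eqP cS ->; split.
- exact: tr_conj_diag_mx.
- rewrite !conjB conjM !diagB mulmx_diag [diag_mx _](_ : _ = 0) ?mulmx0 ?mul0mx //.
  apply/matrixP => i j; rewrite !mxE.
  by case: ifP => _; rewrite subrr ?mul0r ?mulr0 mul0rn.
- by rewrite conjT tr_eig cS.
- by rewrite !conjM diag_mxC.
Qed.

End CommutingSolutions.

(** * Diagonalization of real symmetric matrices and the generic count *)

Lemma real_symmetric_diagonalizable (R : realType) (n : nat) (A : 'M[R]_n) :
  A^T = A -> exists P : 'M[R[i]]_n, exists2 d : 'rV[R[i]]_n,
    P \in unitmx & map_mx (real_complex R) A = invmx P *m diag_mx d *m P.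
Proof.
move=> AT; set B := map_mx _ A.
(* A real symmetric matrix equals its conjugate transpose, so it is normal and the complex spectral
   theorem applies. *)
have BN : B \is normalmx.
  have BT : B^T = B by rewrite /B map_trmx AT.
  apply/normalmxP; rewrite BT [map_mx _ B](_ : _ = B) //.
  by apply/matrixP => i j; rewrite !mxE; exact: conjc_real.
exists (spectralmx B), (spectral_diag B); first exact: spectral_unit.
exact/orthomx_spectralP.
Qed.

Lemma meval_power_sum_disc (F : comNzRingType) (n : nat) (A : 'M[F]_n) :
  (\det (power_sum_mx (generic_mx F n))).@[entries A] = \det (power_sum_mx A).
Proof. by rewrite -det_map_mx map_power_sum_mx generic_mx_eval. Qed.

Theorem corollary4p1 (R : realType) (a b : R) (k n : nat) :
  (1 <= k)%N -> (k <= n)%N -> a <> b ->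
  ED_degree_is (quadratic_model a b k n) 'C(n, k).
Proof.
move=> _ kn /eqP ab; exists [:: \det (power_sum_mx (generic_mx R n))]; split.
  (* The diagonal matrix of [0, ..., n - 1] has distinct eigenvalues, so the zero set of the
     discriminant is proper. *)
  exists (diag_mx (\row_i (i : nat)%:R)); split; first by rewrite tr_diag_mx.
  case=> _ /(_ _ (mem_head _ _)); rewrite meval_power_sum_disc => /eqP.
  apply/negP; rewrite -[diag_mx _]mul1mx -[_ *m diag_mx _]mulmx1 -{1}invmx1.
  apply/det_power_sum_mx_neq0; first exact: unitmx1.
  by move=> i j /eqP; rewrite !mxE eqr_nat => /eqP/val_inj.
move=> A AT DA; set B := map_mx _ A.
have BT : B^T = B by rewrite /B map_trmx AT.
have [P [d PU BE]] := real_symmetric_diagonalizable AT.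
have dI : injective (d 0).
  (* The discriminant of [B] is the image of that of [A] under the embedding of the reals, so it
     stays nonzero. *)
  apply/(det_power_sum_mx_neq0 _ PU); rewrite -BE -map_power_sum_mx det_map_mx.
  rewrite fmorph_eq0; apply/negP => /eqP DA0; apply: DA; split=> // p.
  by rewrite inE => /eqP ->; rewrite meval_power_sum_disc.
have abC : real_complex R a != real_complex R b by rewrite (inj_eq (fmorph_inj _)).
have [s [us ss sE]] :=
  commuting_solutions kn abC PU dI
    (etrans (congr1 trmx (esym BE)) (etrans BT BE)).
exists s; split=> // X; rewrite -sE -BE.
have ME := @complex_locus_quadratic_model R a b k n.
split=> [stX | [XT XE trX XB]].
  have [/ME[XT XE trX] _] := stX.
  by split=> //; exact: (stationary_comm ME BT stX).
by apply: (comm_stationary ME) => //; apply/ME.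
Qed.
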